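(* Let $\lambda, x, y$ be real numbers with $x \neq 1$, $|\lambda y|<1$ and $|\lambda x y|<1$. For $n\ge 0$ put $$T_n(y)=e_{\lambda}(y)-1-\frac{(1)_{1,\lambda}}{1!}y-\frac{(1)_{2,\lambda}}{2!}y^{2}-\cdots-\frac{(1)_{n,\lambda}}{n!}y^{n}=\sum_{k=n+1}^{\infty}\frac{(1)_{k,\lambda}}{k!}y^k .$$ Then $$\frac{1}{x-1}\big(e_{\lambda}(xy)-e_{\lambda}(y)\big)=\sum_{n=0}^{\infty}T_n(y)\,x^{n},$$ and $$\frac{y}{1+\lambda y}\,e_{\lambda}(y)=\sum_{n=0}^{\infty}T_n(y).$$
   Context: For real $\lambda$ the generalized falling factorials are $(x)_{0,\lambda}=1$ and $(x)_{n,\lambda}=x(x-\lambda)(x-2\lambda)\cdots(x-(n-1)\lambda)$ for $n\ge1$. The degenerate exponentials are $e_{\lambda}^{x}(t)=\sum_{n=0}^{\infty}\frac{(x)_{n,\lambda}}{n!}t^{n}$ and $e_{\lambda}(t)=e_{\lambda}^{1}(t)=\sum_{n=0}^{\infty}\frac{(1)_{n,\lambda}}{n!}t^{n}$. For $\lambda\neq 0$ and $|\lambda t|<1$ one has $e_\lambda^x(t)=(1+\lambda t)^{x/\lambda}$, and $e_0(t)=e^t$. *)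

(* Defs.v *)
From Stdlib Require Import Reals Factorial.
From Coquelicot Require Import Coquelicot.
Open Scope R_scope.

(* (x)_{n,lam} = x (x - lam) (x - 2 lam) ... (x - (n-1) lam). *)
Fixpoint gen_falling (lam x : R) (n : nat) : R :=
  match n with
  | O => 1
  | S m => gen_falling lam x m * (x - INR m * lam)
  end.

Definition deg_exp_coef (lam x : R) (n : nat) : R :=
  gen_falling lam x n / INR (fact n).

(* e_lam^x(t), defined by its power series in t for every real lam, including
   lam = 0.  [PSeries] is total, so the value is meaningful only where the series
   converges; this is the case whenever |lam t| < 1. *)
Definition deg_exp_pow (lam x t : R) : R := PSeries (deg_exp_coef lam x) t.

Definition deg_exp (lam t : R) : R := deg_exp_pow lam 1 t.

(* [sum_n a n] is a 0 + ... + a n, and the k = 0 term here is the leading 1. *)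
Definition deg_exp_tail (lam y : R) (n : nat) : R :=
  deg_exp lam y - sum_n (fun k => deg_exp_coef lam 1 k * y ^ k) n.

(* Main.v *)
Require Import Defs.
From Stdlib Require Import Reals Lia Lra.
From Coquelicot Require Import Coquelicot.
Open Scope R_scope.

(** Write [T n] for the tail of [sum u k] after the term of index [n].  Exchanging the
two summations, which is justified by summation by parts, gives
[sum_n w n T n = sum_k W k u k] with [W k = w 0 + ... + w (k - 1)].  Take
[u k = a k y^k] with [f t = sum_k a k t^k].  The weights [w n = x^n], for which
[W k = (x^k - 1) / (x - 1)], give [(f (x y) - f y) / (x - 1)].  The weights [w n = 1],
for which [W k = k], give [y f'(y)], and the degenerate exponential satisfies the
differential equation [(1 + lam t) f'(t) = f t]. *)

Definition series_tail (u : nat -> R) (n : nat) : R := Series u - sum_n u n.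

Lemma series_tail_succ (u : nat -> R) (n : nat) :
  series_tail u (S n) = series_tail u n - u (S n).
Proof. unfold series_tail; rewrite sum_Sn; change plus with Rplus; ring. Qed.

Lemma is_series_series_tail (u : nat -> R) (n : nat) :
  ex_series u -> is_series (fun k => u (S n + k)%nat) (series_tail u n).
Proof.
intros Hu.
apply is_series_incr_n; [lia|].
change (is_series u (Series u - sum_n u n + sum_n u n)).
replace (Series u - sum_n u n + sum_n u n) with (Series u) by ring.
now apply Series_correct.
Qed.

Lemma is_lim_seq_series_tail (u : nat -> R) :
  ex_series u -> is_lim_seq (series_tail u) 0.
Proof.
intros Hu.
replace (Finite 0) with (Finite (Series u - Series u)) by (f_equal; ring).
apply is_lim_seq_minus'; [apply is_lim_seq_const|].
exact (Series_correct _ Hu).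
Qed.

Lemma ex_series_Rabs_le (u v : nat -> R) :
  (forall k, Rabs (u k) <= v k) -> ex_series v -> ex_series (fun k => Rabs (u k)).
Proof.
intros Huv; apply (ex_series_le (V := R_CompleteNormedModule)); intros k.
change (Rabs (Rabs (u k)) <= v k); now rewrite Rabs_Rabsolu.
Qed.

Lemma Rabs_Series_le (u v : nat -> R) :
  (forall k, Rabs (u k) <= v k) -> ex_series v -> Rabs (Series u) <= Series v.
Proof.
intros Huv Hv.
apply Rle_trans with (1 := Series_Rabs _ (ex_series_Rabs_le u v Huv Hv)).
apply Series_le; [|exact Hv].
intros k; split; [apply Rabs_pos|apply Huv].
Qed.

Lemma is_lim_seq_mul_series_tail (W u v : nat -> R) :
  (forall n k, (n < k)%nat -> Rabs (W n * u k) <= v k) ->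
  ex_series u -> ex_series v ->
  is_lim_seq (fun n => W n * series_tail u n) 0.
Proof.
intros HW Hu Hv.
apply is_lim_seq_abs_0.
apply is_lim_seq_le_le with (u := fun _ => 0) (w := series_tail v);
  [|apply is_lim_seq_const|now apply is_lim_seq_series_tail].
intros n; split; [apply Rabs_pos|].
assert (Hvn := is_series_series_tail v n Hv).
rewrite <- (is_series_unique _ _ (is_series_series_tail u n Hu)).
rewrite <- (is_series_unique _ _ Hvn), <- Series_scal_l.
apply Rabs_Series_le; [|eexists; exact Hvn].
intros k; apply HW; lia.
Qed.

Lemma sum_n_mul_series_tail (W u : nat -> R) (n : nat) :
  W O = 0 ->
  sum_n (fun k => (W (S k) - W k) * series_tail u k) n =
  W (S n) * series_tail u n + sum_n (fun k => W k * u k) n :> R.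
Proof.
intros HW0; induction n as [|n IH].
- rewrite !sum_O, HW0; ring.
- rewrite !sum_Sn, IH, series_tail_succ; change plus with Rplus; ring.
Qed.

Lemma is_series_mul_series_tail (W u v : nat -> R) :
  W O = 0 -> (forall n k, (n <= k)%nat -> Rabs (W n * u k) <= v k) ->
  ex_series u -> ex_series v ->
  is_series (fun n => (W (S n) - W n) * series_tail u n)
    (Series (fun k => W k * u k)).
Proof.
intros HW0 HW Hu Hv.
change (is_lim_seq (sum_n (fun n => (W (S n) - W n) * series_tail u n))
  (Series (fun k => W k * u k))).
apply is_lim_seq_ext with
  (u := fun n => W (S n) * series_tail u n + sum_n (fun k => W k * u k) n).
- intros n; symmetry; now apply sum_n_mul_series_tail.
- rewrite <- (Rplus_0_l (Series _)).
  apply is_lim_seq_plus'.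
  + apply (is_lim_seq_mul_series_tail (fun n => W (S n)) u v); auto.
  + apply (Series_correct (fun k => W k * u k)), ex_series_Rabs.
    apply ex_series_Rabs_le with v; auto.
Qed.

Lemma Rabs_pow_le_1_plus (x : R) (n k : nat) :
  (n <= k)%nat -> Rabs (x ^ n) <= 1 + Rabs (x ^ k).
Proof.
intros Hnk.
assert (Hk := Rabs_pos (x ^ k)).
destruct (Rle_or_lt (Rabs x) 1) as [Hx|Hx].
- assert (Hn : Rabs x ^ n <= 1 ^ n)
    by (apply pow_incr; split; [apply Rabs_pos|exact Hx]).
  rewrite pow1, RPow_abs in Hn; lra.
- assert (Hmono := Power_monotonic x n k Hx Hnk); lra.
Qed.

Lemma is_series_series_tail_mul_pow (x : R) (u : nat -> R) :
  x <> 1 -> ex_series (fun k => Rabs (u k)) ->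
  ex_series (fun k => Rabs (u k * x ^ k)) ->
  is_series (fun n => series_tail u n * x ^ n)
    (1 / (x - 1) * (Series (fun k => u k * x ^ k) - Series u)).
Proof.
intros Hx Hu Hux.
set (W := fun n => / (x - 1) * (x ^ n - 1)).
set (v := fun k => Rabs (/ (x - 1)) * (2 * Rabs (u k) + Rabs (u k * x ^ k))).
assert (HW : forall n k, (n <= k)%nat -> Rabs (W n * u k) <= v k).
{ intros n k Hnk; unfold W, v.
  rewrite !Rabs_mult, Rmult_assoc.
  apply Rmult_le_compat_l; [apply Rabs_pos|].
  replace (2 * Rabs (u k) + Rabs (u k) * Rabs (x ^ k)) with
    ((1 + Rabs (x ^ k) + 1) * Rabs (u k)) by ring.
  apply Rmult_le_compat_r; [apply Rabs_pos|].
  apply Rle_trans with (1 := Rabs_triang _ _).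
  rewrite Rabs_Ropp, Rabs_R1.
  now apply Rplus_le_compat_r, Rabs_pow_le_1_plus. }
assert (Hv : ex_series v).
{ apply (ex_series_scal_l (K := R_AbsRing) (V := R_NormedModule) (Rabs (/ (x - 1)))
    (fun k => 2 * Rabs (u k) + Rabs (u k * x ^ k))).
  apply (ex_series_plus (K := R_AbsRing) (V := R_NormedModule)); [|exact Hux].
  exact (ex_series_scal_l (K := R_AbsRing) 2 _ Hu). }
replace (1 / (x - 1) * _) with (Series (fun k => W k * u k)).
- apply is_series_ext with (a := fun n => (W (S n) - W n) * series_tail u n).
  + intros n; unfold W; simpl; field; lra.
  + apply is_series_mul_series_tail with v; auto using ex_series_Rabs.
    unfold W; simpl; ring.
- rewrite <- Series_minus, <- Series_scal_l by now apply ex_series_Rabs.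
  apply Series_ext; intros k; unfold W; field; lra.
Qed.

Lemma is_series_sum_series_tail (u : nat -> R) :
  ex_series (fun k => Rabs (INR k * u k)) ->
  is_series (series_tail u) (Series (fun k => INR k * u k)).
Proof.
intros Hku.
assert (Hle : forall n k, (n <= k)%nat ->
  Rabs (INR n * u k) <= Rabs (INR k * u k)).
{ intros n k Hnk; rewrite !Rabs_mult, !(Rabs_right (INR _))
    by apply Rle_ge, pos_INR.
  apply Rmult_le_compat_r; [apply Rabs_pos|now apply le_INR]. }
assert (Hu : ex_series u).
{ apply ex_series_incr_1, ex_series_Rabs.
  apply ex_series_Rabs_le with (fun k => Rabs (INR (S k) * u (S k))).
  - intros k; rewrite <- (Rmult_1_l (u (S k))) at 1.
    apply (Hle 1%nat); lia.
  - exact (proj1 (ex_series_incr_1 _) Hku). }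
apply is_series_ext with (a := fun n => (INR (S n) - INR n) * series_tail u n).
- intros n; rewrite S_INR, Rplus_minus_l; apply Rmult_1_l.
- now apply is_series_mul_series_tail with (2 := Hle).
Qed.

Definition PSeries_tail (a : nat -> R) (t : R) : nat -> R :=
  series_tail (fun k => a k * t ^ k).

Lemma is_series_PSeries_tail_mul_pow (a : nat -> R) (x y : R) :
  x <> 1 -> CV_disk a y -> CV_disk a (x * y) ->
  is_series (fun n => PSeries_tail a y n * x ^ n)
    (1 / (x - 1) * (PSeries a (x * y) - PSeries a y)).
Proof.
intros Hx Hy Hxy.
assert (Hpow : forall k, a k * (x * y) ^ k = a k * y ^ k * x ^ k)
  by (intros k; rewrite Rpow_mult_distr; ring).
unfold PSeries; rewrite (Series_ext _ _ Hpow).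
apply is_series_series_tail_mul_pow; [exact Hx|exact Hy|].
apply ex_series_ext with (2 := Hxy).
intros k; now rewrite Hpow.
Qed.

Lemma PS_incr_1_derive (a : nat -> R) (n : nat) :
  PS_incr_1 (PS_derive a) n = INR n * a n.
Proof. destruct n; [symmetry; apply Rmult_0_l|reflexivity]. Qed.

Lemma is_series_sum_PSeries_tail (a : nat -> R) (y : R) :
  Rbar_lt (Rabs y) (CV_radius a) ->
  is_series (PSeries_tail a y) (y * Derive (PSeries a) y).
Proof.
intros Hy.
assert (Hterm : forall k, PS_incr_1 (PS_derive a) k * y ^ k = INR k * (a k * y ^ k))
  by (intros k; rewrite PS_incr_1_derive; ring).
rewrite Derive_PSeries, <- PSeries_incr_1 by exact Hy.
unfold PSeries; rewrite (Series_ext _ _ Hterm).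
apply is_series_sum_series_tail.
apply ex_series_ext with (a := fun k => Rabs (PS_incr_1 (PS_derive a) k * y ^ k)).
- intros k; now rewrite Hterm.
- apply CV_disk_inside; now rewrite CV_radius_incr_1, CV_radius_derive.
Qed.

Lemma CV_radius_decr_n (a : nat -> R) (n : nat) :
  CV_radius (PS_decr_n a n) = CV_radius a.
Proof.
induction n as [|n IH]; [reflexivity|].
rewrite <- IH, <- (CV_radius_decr_1 (PS_decr_n a n)).
apply CV_radius_ext; intros k.
unfold PS_decr_1, PS_decr_n; now rewrite Nat.add_succ_r.
Qed.

(* Unlike in d'Alembert's criterion, coefficients may vanish: those of the degenerate
exponential do from some index on when [x / lam] is a natural number. *)
Lemma CV_radius_ge_of_ratio (a : nat -> R) (r : R) (N : nat) :
  (forall n, (N <= n)%nat -> Rabs (a (S n)) * Rabs r <= Rabs (a n)) ->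
  Rbar_le r (CV_radius a).
Proof.
intros Hratio.
rewrite <- (CV_radius_decr_n a N).
apply (proj1 (CV_radius_bounded (PS_decr_n a N))).
exists (Rabs (a N)); intros n; unfold PS_decr_n.
induction n as [|n IH].
- rewrite Nat.add_0_r, Rmult_1_r; apply Rle_refl.
- apply Rle_trans with (2 := IH).
  rewrite Nat.add_succ_r; simpl pow.
  rewrite <- Rmult_assoc, !Rabs_mult.
  apply Rmult_le_compat_r; [apply Rabs_pos|apply Hratio; lia].
Qed.

Lemma deg_exp_coef_succ (lam x : R) (n : nat) :
  INR (S n) * deg_exp_coef lam x (S n) = (x - INR n * lam) * deg_exp_coef lam x n.
Proof.
unfold deg_exp_coef.
rewrite fact_simpl, mult_INR; simpl gen_falling.
field; split; [apply INR_fact_neq_0|apply not_0_INR; lia].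
Qed.

Lemma CV_radius_deg_exp_coef_ge (lam x r : R) :
  Rabs (lam * r) < 1 -> Rbar_le r (CV_radius (deg_exp_coef lam x)).
Proof.
rewrite Rabs_mult; intros Hlr.
destruct (INR_archimed (1 - Rabs lam * Rabs r) (Rabs x * Rabs r)) as [N HN]; [lra|].
apply CV_radius_ge_of_ratio with N; intros n Hn.
assert (Hxr : Rabs x * Rabs r <= INR n * (1 - Rabs lam * Rabs r))
  by (apply le_INR in Hn; nra).
assert (Hfactor : Rabs (x - INR n * lam) <= Rabs x + INR n * Rabs lam).
{ apply Rle_trans with (1 := Rabs_triang _ _).
  rewrite Rabs_Ropp, Rabs_mult, (Rabs_right (INR n)) by apply Rle_ge, pos_INR.
  lra. }
assert (HSn : 0 < INR (S n)) by apply lt_0_INR, Nat.lt_0_succ.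
assert (Hrec : INR (S n) * Rabs (deg_exp_coef lam x (S n)) =
  Rabs (x - INR n * lam) * Rabs (deg_exp_coef lam x n)).
{ rewrite <- Rabs_mult, <- deg_exp_coef_succ, Rabs_mult.
  now rewrite (Rabs_right (INR (S n))) by lra. }
apply Rmult_le_reg_l with (1 := HSn).
rewrite <- Rmult_assoc, Hrec.
replace (Rabs (x - INR n * lam) * Rabs (deg_exp_coef lam x n) * Rabs r) with
  (Rabs (x - INR n * lam) * Rabs r * Rabs (deg_exp_coef lam x n)) by ring.
apply Rmult_le_compat_r; [apply Rabs_pos|].
apply Rle_trans with ((Rabs x + INR n * Rabs lam) * Rabs r).
- apply Rmult_le_compat_r; [apply Rabs_pos|exact Hfactor].
- rewrite S_INR; lra.
Qed.

Lemma CV_radius_deg_exp_coef_gt (lam x t : R) :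
  Rabs (lam * t) < 1 -> Rbar_lt (Rabs t) (CV_radius (deg_exp_coef lam x)).
Proof.
rewrite Rabs_mult; intros Ht.
assert (Hlam := Rabs_pos lam); assert (Habs := Rabs_pos t).
set (d := (1 - Rabs lam * Rabs t) / (1 + Rabs lam)).
assert (Hd : d * (1 + Rabs lam) = 1 - Rabs lam * Rabs t)
  by (unfold d; field; lra).
assert (Hd0 : 0 < d) by (apply Rdiv_lt_0_compat; lra).
apply Rbar_lt_le_trans with (Rabs t + d); [simpl; lra|].
apply CV_radius_deg_exp_coef_ge.
rewrite Rabs_mult, (Rabs_right (Rabs t + d)) by lra; lra.
Qed.

Lemma PS_derive_deg_exp_coef (lam x : R) (n : nat) :
  PS_plus (PS_derive (deg_exp_coef lam x))
    (PS_scal lam (PS_incr_1 (PS_derive (deg_exp_coef lam x)))) n =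
  PS_scal x (deg_exp_coef lam x) n.
Proof.
unfold PS_plus, PS_scal; rewrite PS_incr_1_derive.
unfold PS_derive; rewrite deg_exp_coef_succ.
change plus with Rplus; change scal with Rmult; simpl; ring.
Qed.

Lemma is_derive_deg_exp_pow (lam x t : R) :
  Rabs (lam * t) < 1 ->
  is_derive (deg_exp_pow lam x) t (x / (1 + lam * t) * deg_exp_pow lam x t).
Proof.
intros Ht.
set (a := deg_exp_coef lam x).
assert (Ha : Rbar_lt (Rabs t) (CV_radius a))
  by now apply CV_radius_deg_exp_coef_gt.
assert (Hne : 1 + lam * t <> 0) by (apply Rabs_def2 in Ht; lra).
assert (Hda : ex_pseries (PS_derive a) t)
  by (apply CV_radius_inside; now rewrite CV_radius_derive).
assert (Hode : PSeries (PS_derive a) t * (1 + lam * t) = x * PSeries a t).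
{ rewrite <- PSeries_scal.
  rewrite <- (PSeries_ext _ (PS_scal x a) t (PS_derive_deg_exp_coef lam x)); fold a.
  rewrite PSeries_plus, PSeries_scal, PSeries_incr_1; [ring|exact Hda|].
  apply ex_pseries_scal; [apply Rmult_comm|now apply ex_pseries_incr_1]. }
replace (x / (1 + lam * t) * deg_exp_pow lam x t) with (PSeries (PS_derive a) t).
- now apply is_derive_PSeries.
- apply Rmult_eq_reg_r with (2 := Hne); rewrite Hode.
  unfold deg_exp_pow; fold a; field; exact Hne.
Qed.

Theorem theorem2p1 (lam x y : R) (hx : x <> 1)
    (hy : Rabs (lam * y) < 1) (hxy : Rabs (lam * x * y) < 1) :
  (forall n : nat,
      is_series (fun k : nat => deg_exp_coef lam 1 (n + 1 + k) * y ^ (n + 1 + k))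
                (deg_exp_tail lam y n)) /\
  is_series (fun n : nat => deg_exp_tail lam y n * x ^ n)
            (1 / (x - 1) * (deg_exp lam (x * y) - deg_exp lam y)) /\
  is_series (fun n : nat => deg_exp_tail lam y n)
            (y / (1 + lam * y) * deg_exp lam y).
Proof.
set (a := deg_exp_coef lam 1).
change (deg_exp_tail lam y) with (PSeries_tail a y).
assert (Hy : Rbar_lt (Rabs y) (CV_radius a))
  by now apply CV_radius_deg_exp_coef_gt.
assert (Hxy : Rbar_lt (Rabs (x * y)) (CV_radius a))
  by (apply CV_radius_deg_exp_coef_gt; now rewrite <- Rmult_assoc).
split; [|split].
- intros n; rewrite Nat.add_1_r.
  apply (is_series_series_tail (fun k => a k * y ^ k)).
  now apply ex_series_Rabs, CV_disk_inside.
- now apply is_series_PSeries_tail_mul_pow; [|apply CV_disk_inside..].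
- replace (y / (1 + lam * y) * deg_exp lam y) with (y * Derive (deg_exp_pow lam 1) y).
  + now apply (is_series_sum_PSeries_tail a).
  + rewrite (is_derive_unique _ _ _ (is_derive_deg_exp_pow lam 1 y hy)).
    unfold deg_exp, Rdiv; ring.
Qed.
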